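(* Let $(\mathfrak g,[\cdot,\dots,\cdot])$ be an $n$-Lie algebra and $(V;\rho)$ a representation of $\mathfrak g$. A linear map $T:V\to\mathfrak g$ is an $\mathcal O$-operator if and only if the linear map $\overline T=\begin{pmatrix}0&T\\0&0\end{pmatrix}:\mathfrak g\oplus V\to\mathfrak g\oplus V$, i.e. $\overline T(x+v)=Tv$ for $x\in\mathfrak g$, $v\in V$, is a Nijenhuis operator on the semidirect product $n$-Lie algebra $\mathfrak g\ltimes_\rho V$.
   Context: Let $n\ge 2$. An $n$-Lie algebra is a vector space $\mathfrak g$ with an $n$-multilinear skew-symmetric bracket $[\cdot,\dots,\cdot]:\wedge^n\mathfrak g\to\mathfrak g$ satisfying $[x_1,\dots,x_{n-1},[y_1,\dots,y_n]]=\sum_{i=1}^n[y_1,\dots,[x_1,\dots,x_{n-1},y_i],\dots,y_n]$ for all $x_i,y_i\in\mathfrak g$. For $X=(x_1,\dots,x_{n-1})$ and $Y=(y_1,\dots,y_{n-1})$ in $\wedge^{n-1}\mathfrak g$ put $X\circ Y=\sum_{i=1}^{n-1}(y_1,\dots,y_{i-1},[x_1,\dots,x_{n-1},y_i],y_{i+1},\dots,y_{n-1})$. A representation of $\mathfrak g$ on a vector space $V$ is a multilinear map $\rho:\wedge^{n-1}\mathfrak g\to\mathfrak{gl}(V)$ such that $[\rho(X),\rho(Y)]=\rho(X\circ Y)$ for all $X,Y\in\wedge^{n-1}\mathfrak g$ and $\rho(x_1,\dots,x_{n-2},[y_1,\dots,y_n])=\sum_{i=1}^n(-1)^{n-i}\rho(y_1,\dots,\hat{y_i},\dots,y_n)\rho(x_1,\dots,x_{n-2},y_i)$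 for all $x_i,y_i\in\mathfrak g$ (a hat denotes omission). The semidirect product $\mathfrak g\ltimes_\rho V$ is the $n$-Lie algebra on $\mathfrak g\oplus V$ with bracket $[x_1+v_1,\dots,x_n+v_n]=[x_1,\dots,x_n]+\sum_{i=1}^n(-1)^{n-i}\rho(x_1,\dots,\hat{x_i},\dots,x_n)(v_i)$. A linear map $T:V\to\mathfrak g$ is an $\mathcal O$-operator if for all $v_1,\dots,v_n\in V$, $[Tv_1,\dots,Tv_n]=\sum_{i=1}^n(-1)^{n-i}T\big(\rho(Tv_1,\dots,\widehat{Tv_i},\dots,Tv_n)(v_i)\big)$. For a linear map $N$ on an $n$-Lie algebra, define $n$-ary brackets $[\cdot,\dots,\cdot]_N^j$, $1\le j\le n-1$, by $[x_1,\dots,x_n]_N^1=\sum_{i=1}^n[x_1,\dots,Nx_i,\dots,x_n]-N[x_1,\dots,x_n]$ and, for $2\le j\le n-1$, $[x_1,\dots,x_n]_N^j=\sum_{i_1<\dots<i_j}[\dots,Nx_{i_1},\dots,Nx_{i_j},\dots]-N[x_1,\dots,x_n]_N^{j-1}$, where in the summand $N$ is applied exactly to the entries in positions $i_1,\dots,i_j$. The linear map $N$ is a Nijenhuis operator if $[Nx_1,\dots,Nx_n]=N([x_1,\dots,x_n]_N^{n-1})$ for all $x_1,\dots,x_n$. *)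

(* Defs.v *)
From HB Require Import structures.
From mathcomp Require Import all_boot all_order all_fingroup all_algebra.

Set Implicit Arguments.
Unset Strict Implicit.
Unset Printing Implicit Defensive.

Import GRing.Theory.
Local Open Scope ring_scope.

(** Argument lists are finite functions on ['I_n], so positions are numbered
    from 0: the argument x_i is [x j] with [i = j.+1], and its sign (-1)^(n-i)
    reads [(-1) ^+ (n - j.+1)]. *)

Section Arguments.
Variables (n : nat) (E : Type).

Definition upd (x : {ffun 'I_n -> E}) (i : 'I_n) (a : E) : {ffun 'I_n -> E} :=
  [ffun j => if j == i then a else x j].

Definition omit (i : 'I_n) (x : {ffun 'I_n -> E}) : {ffun 'I_n.-1 -> E} :=
  [ffun k => x (lift i k)].

(** [(x_1, ..., x_(n-1), a)] *)
Definition snoc (x : {ffun 'I_n.-1 -> E}) (a : E) : {ffun 'I_n -> E} :=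
  [ffun j : 'I_n => if (insub (val j) : option 'I_n.-1) is Some k
                    then x k else a].

End Arguments.

Definition multilinear (F : fieldType) (n : nat) (U W : lmodType F)
    (f : {ffun 'I_n -> U} -> W) : Prop :=
  forall (x : {ffun 'I_n -> U}) (i : 'I_n), linear (fun a : U => f (upd x i a)).

(** Together with [multilinear]: [f] is a linear map on the [n]-th exterior
    power; away from characteristic 2 this is skew-symmetry. *)
Definition alternating (F : fieldType) (n : nat) (U W : lmodType F)
    (f : {ffun 'I_n -> U} -> W) : Prop :=
  forall (x : {ffun 'I_n -> U}) (i j : 'I_n), i != j -> x i = x j -> f x = 0.

Record nLieAlgebra (F : fieldType) (n : nat) (g : lmodType F) := NLieAlgebra {
  nlie_bracket :> {ffun 'I_n -> g} -> g;
  nlie_multilinear : multilinear nlie_bracket;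
  nlie_alternating : alternating nlie_bracket;
  nlie_fundamental : forall (x : {ffun 'I_n.-1 -> g}) (y : {ffun 'I_n -> g}),
    nlie_bracket (snoc x (nlie_bracket y)) =
    \sum_(i < n) nlie_bracket (upd y i (nlie_bracket (snoc x (y i)))) }.

(** Equalities in gl(V) are stated pointwise.  X o Y is a sum of decomposable
    elements of the exterior power, on which rho is additive; hence the sum in
    [rep_commutator]. *)
Record representation (F : fieldType) (n : nat) (g : lmodType F)
    (L : nLieAlgebra n g) (V : lmodType F) := Representation {
  rep_map :> {ffun 'I_n.-1 -> g} -> {linear V -> V};
  rep_multilinear : forall v : V, multilinear (fun x => rep_map x v);
  rep_alternating : forall v : V, alternating (fun x => rep_map x v);
  rep_commutator : forall (x y : {ffun 'I_n.-1 -> g}) (v : V),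
    rep_map x (rep_map y v) - rep_map y (rep_map x v) =
    \sum_(i < n.-1) rep_map (upd y i (L (snoc x (y i)))) v;
  rep_bracket : forall (x : {ffun 'I_n.-1.-1 -> g}) (y : {ffun 'I_n -> g})
                       (v : V),
    rep_map (snoc x (L y)) v =
    \sum_(i < n) (-1) ^+ (n - i.+1) *:
      rep_map (omit i y) (rep_map (snoc x (y i)) v) }.

Section Semidirect.
Variables (F : fieldType) (n : nat) (g : lmodType F) (L : nLieAlgebra n g).
Variables (V : lmodType F) (rho : representation L V).

Definition proj_g (p : {ffun 'I_n -> g * V}) : {ffun 'I_n -> g} :=
  [ffun i => (p i).1].

(** \sum_i (-1)^(n-i) rho(x_1, ..., ^x_i, ..., x_n)(v_i) *)
Definition rep_action (x : {ffun 'I_n -> g}) (v : {ffun 'I_n -> V}) : V :=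
  \sum_(i < n) (-1) ^+ (n - i.+1) *: rho (omit i x) (v i).

Definition semidirect_bracket (p : {ffun 'I_n -> g * V}) : g * V :=
  (L (proj_g p), rep_action (proj_g p) [ffun i => (p i).2]).

End Semidirect.

Lemma upd_same n (E : Type) (x : {ffun 'I_n -> E}) i a : upd x i a i = a.
Proof. by rewrite ffunE eqxx. Qed.

Lemma upd_other n (E : Type) (x : {ffun 'I_n -> E}) i a j :
  j != i -> upd x i a j = x j.
Proof. by move=> /negPf ji; rewrite ffunE ji. Qed.

Lemma upd_upd n (E : Type) (x : {ffun 'I_n -> E}) i a b :
  upd (upd x i a) i b = upd x i b.
Proof. by apply/ffunP => j; rewrite !ffunE; case: eqP. Qed.

Lemma upd_id n (E : Type) (x : {ffun 'I_n -> E}) i : upd x i (x i) = x.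
Proof. by apply/ffunP => j; rewrite !ffunE; case: eqP => // ->. Qed.

Lemma updC n (E : Type) (x : {ffun 'I_n -> E}) i j a b : i != j ->
  upd (upd x i a) j b = upd (upd x j b) i a.
Proof.
move=> ij; apply/ffunP => k; rewrite !ffunE.
by case: (k =P j) => // ->; rewrite eq_sym (negPf ij).
Qed.

Lemma omit_upd_same n (E : Type) (x : {ffun 'I_n -> E}) i a :
  omit i (upd x i a) = omit i x.
Proof. by apply/ffunP => k; rewrite !ffunE eq_sym (negPf (neq_lift _ _)). Qed.

Lemma omit_upd_lift n (E : Type) (x : {ffun 'I_n -> E}) i k a :
  omit i (upd x (lift i k) a) = upd (omit i x) k a.
Proof. by apply/ffunP => j; rewrite !ffunE (inj_eq lift_inj). Qed.

Lemma snocT n (E : Type) (x : {ffun 'I_n -> E}) a (j : 'I_n.+1) :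
  snoc (n := n.+1) x a j = if unlift ord_max j is Some k then x k else a.
Proof.
rewrite ffunE; case: unliftP => [k|] ->.
  have -> : val (lift (ord_max : 'I_n.+1) k) = val k := lift_max k.
  by rewrite valK.
by rewrite insubN //= ltnn.
Qed.

Lemma bump_lt h k : (k < h)%N -> bump h k = k.
Proof. by rewrite ltnNge /bump => /negPf->. Qed.

Lemma snoc_max n (E : Type) (x : {ffun 'I_n -> E}) a :
  snoc (n := n.+1) x a ord_max = a.
Proof. by rewrite snocT unlift_none. Qed.

Lemma snoc_lift n (E : Type) (x : {ffun 'I_n -> E}) a k :
  snoc (n := n.+1) x a (lift ord_max k) = x k.
Proof. by rewrite snocT liftK. Qed.

Lemma omit_snoc_max n (E : Type) (x : {ffun 'I_n -> E}) a :
  omit ord_max (snoc (n := n.+1) x a) = x.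
Proof. by apply/ffunP => k; rewrite ffunE snoc_lift. Qed.

Lemma omit_snoc_lift n (E : Type) (x : {ffun 'I_n.+1 -> E}) a k :
  omit (lift ord_max k) (snoc (n := n.+2) x a) =
  snoc (n := n.+1) (omit k x) a.
Proof.
apply/ffunP => j; rewrite ffunE; case: (unliftP ord_max j) => [l|] ->.
  rewrite snoc_lift [RHS]ffunE.
  have -> : lift (lift ord_max k) (lift ord_max l) =
            lift ord_max (lift k l) :> 'I_n.+2.
    apply: val_inj; rewrite /= (bump_lt (ltn_ord k)) (bump_lt (ltn_ord l)).
    by rewrite (bump_lt (ltn_ord (lift k l))).
  by rewrite snoc_lift.
have -> : lift (lift ord_max k) ord_max = ord_max :> 'I_n.+2.
  apply: val_inj; rewrite /= (bump_lt (ltn_ord k)).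
  by rewrite /bump -ltnS ltn_ord.
by rewrite !snoc_max.
Qed.

Section Alternating.
Variables (F : fieldType) (n : nat) (U W : lmodType F).
Variable f : {ffun 'I_n -> U} -> W.
Hypotheses (mf : multilinear f) (af : alternating f).

Lemma multilinear_upd0 x i : f (upd x i 0) = 0.
Proof.
have := mf x i (-1) 0 0; rewrite scaler0 addr0 => ->.
by rewrite scaleN1r addNr.
Qed.

Lemma multilinear_updD x i a b : f (upd x i (a + b)) = f (upd x i a) + f (upd x i b).
Proof. by have := mf x i 1 a b; rewrite !scale1r. Qed.

Lemma multilinear_updZ x i c a : f (upd x i (c *: a)) = c *: f (upd x i a).
Proof. by have := mf x i c a 0; rewrite !addr0 multilinear_upd0 addr0. Qed.

Lemma multilinear_updN x i a : f (upd x i (- a)) = - f (upd x i a).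
Proof. by rewrite -scaleN1r multilinear_updZ scaleN1r. Qed.

Lemma alternating_tperm (x : {ffun 'I_n -> U}) i j : i != j ->
  f [ffun k => x (tperm i j k)] = - f x.
Proof.
move=> ij; have ji : j != i by rewrite eq_sym.
pose w a b := f (upd (upd x i a) j b).
have wD a b c : w (a + b) c = w a c + w b c.
  by rewrite /w !(updC _ _ _ ij) multilinear_updD.
have wDr a b c : w a (b + c) = w a b + w a c by rewrite /w multilinear_updD.
have w0 a : w a a = 0.
  by apply: (af ij); rewrite upd_same upd_other // upd_same.
have := w0 (x i + x j); rewrite wD !wDr !w0 add0r addr0.
have -> : w (x i) (x j) = f x.
  congr (f _); apply/ffunP => k; rewrite !ffunE.
  by case: eqP => [->//|_]; case: eqP => [->//|].
have -> : w (x j) (x i) = f [ffun k => x (tperm i j k)].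
  congr (f _); apply/ffunP => k; rewrite !ffunE.
  by case: tpermP => [->|->|/eqP/negPf-> /eqP/negPf->//]; rewrite eqxx // (negPf ij).
by rewrite addrC => /eqP; rewrite addr_eq0 => /eqP.
Qed.

Lemma alternating_perm (s : 'S_n) (x : {ffun 'I_n -> U}) :
  f [ffun k => x (s k)] = (-1) ^+ s *: f x.
Proof.
have [ts -> dts] := prod_tpermP s; elim: ts dts x => [_|t ts IH] /=.
  move=> x; rewrite big_nil odd_perm1 scale1r; congr (f _).
  by apply/ffunP => k; rewrite ffunE perm1.
case/andP => dt dts x; rewrite big_cons odd_permM odd_tperm dt.
set s' := (\prod_(i <- ts) _)%g.
have -> : [ffun k => x ((tperm t.1 t.2 * s')%g k)] =
   [ffun k => [ffun k' => x (s' k')] (tperm t.1 t.2 k)].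
  by apply/ffunP => k; rewrite !ffunE permM.
by rewrite alternating_tperm // IH // signr_addb expr1 mulN1r scaleNr.
Qed.

End Alternating.

Lemma tperm_lift n (i j : 'I_n) : i != j ->
  exists2 s : 'S_n.-1, forall k, lift j (s k) = tperm i j (lift i k)
                     & odd_perm s = ~~ (odd i (+) odd j).
Proof.
case: n i j => [|m] i j ij; first by case: i ij.
 pose t := tperm i j.
have tj k : unlift j (t (lift i k)) != None.
  case: unliftP => // e; have := neq_lift i k.
  by rewrite -(inj_eq (@perm_inj _ t)) e tpermL eqxx.
pose h k := odflt k (unlift j (t (lift i k))).
have hE k : lift j (h k) = t (lift i k).
  by rewrite /h; case: unliftP (tj k).
have h_inj : injective h.
  by move=> k l e; have := hE k; rewrite e hE => /perm_inj/lift_inj->.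
pose s := perm h_inj; exists s; first by move=> k; rewrite permE hE.
have ts : t = lift_perm i j s.
  apply/permP => k; case: (unliftP i k) => [l|] ->.
    by rewrite lift_perm_lift (permE h_inj) hE.
  by rewrite lift_perm_id tpermL.
have := odd_lift_perm i j s; rewrite -ts odd_tperm ij.
by case: (odd i) (odd j) (odd_perm s) => [] [] [].
Qed.

Section SemidirectNLie.
Variables (F : fieldType) (n : nat) (g : lmodType F) (L : nLieAlgebra n g).
Variables (V : lmodType F) (rho : representation L V).

Local Notation sdb := (semidirect_bracket rho).

Lemma proj_g_upd (p : {ffun 'I_n -> g * V}) i a :
  proj_g (upd p i a) = upd (proj_g p) i a.1.
Proof. by apply/ffunP => j; rewrite !ffunE; case: eqP. Qed.

Lemma semidirect_multilinear : multilinear sdb.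
Proof.
move=> p i c a b; rewrite /semidirect_bracket !proj_g_upd.
congr pair; first exact: nlie_multilinear.
rewrite /rep_action /= scaler_sumr -big_split /=; apply: eq_bigr => j _.
rewrite !ffunE; case: (unliftP j i) => [k|] ->.
  rewrite (negPf (neq_lift _ _)) !omit_upd_lift.
  by rewrite (rep_multilinear rho) scalerDr !scalerA mulrC.
rewrite eqxx !omit_upd_same linearP scalerDr !scalerA.
by rewrite mulrC.
Qed.

Lemma omit_swap (x : {ffun 'I_n -> g}) (i j : 'I_n) (v : V) :
  i != j -> x i = x j ->
  (-1) ^+ (n - i.+1) *: rho (omit i x) v =
  - ((-1) ^+ (n - j.+1) *: rho (omit j x) v).
Proof.
move=> ij xij; have [s hs os] := tperm_lift ij.
have -> : omit i x = [ffun k => omit j x (s k)].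
  apply/ffunP => k; rewrite !ffunE hs.
  by case: tpermP => [e|->//|//]; rewrite e ?xij // .
rewrite (alternating_perm (rep_multilinear rho v) (rep_alternating rho v)).
rewrite scalerA -scaleNr; congr (_ *: _).
rewrite os -signr_odd -[in RHS]signr_odd -signr_addb -signrN.
rewrite !oddB ?ltn_ord //=; congr (_ ^+ _).
by case: (odd n) (odd i) (odd j) => [] [] [].
Qed.

Lemma semidirect_alternating : alternating sdb.
Proof.
move=> p i j ij pij; congr pair.
  by apply: (nlie_alternating L ij); rewrite !ffunE pij.
rewrite /rep_action (bigD1 i) //= (bigD1 j) 1?eq_sym //=.
rewrite big1 ?addr0 => [|k /andP[ki kj]].
  by rewrite (omit_swap _ ij) !ffunE pij // addNr.
case: (unliftP k i) ki => [i' ei _|->]; last by rewrite eqxx.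
case: (unliftP k j) kj => [j' ej _|->]; last by rewrite eqxx.
rewrite (rep_alternating rho _ (i := i') (j := j')) ?scaler0 //.
  by apply: contra ij => /eqP e; rewrite ei ej e.
by rewrite !ffunE -ei -ej pij.
Qed.

Lemma rep_action_upd (x : {ffun 'I_n -> g}) (v : {ffun 'I_n -> V}) i c z :
  rep_action rho (upd x i c) (upd v i z) =
  (-1) ^+ (n - i.+1) *: rho (omit i x) z +
  \sum_(j < n | j != i) (-1) ^+ (n - j.+1) *: rho (omit j (upd x i c)) (v j).
Proof.
rewrite /rep_action (bigD1 i) //= omit_upd_same upd_same; congr (_ + _).
by apply: eq_bigr => j ji; rewrite upd_other.
Qed.

Lemma proj_g_snoc (p : {ffun 'I_n.-1 -> g * V}) a :
  proj_g (snoc p a) = snoc [ffun k => (p k).1] a.1.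
Proof. by apply/ffunP => j; rewrite !ffunE; case: insub => // k; rewrite ffunE. Qed.

End SemidirectNLie.

Section SemidirectFundamental.
Variables (F : fieldType) (g V : lmodType F).

Lemma rep_bracket_omit m (L : nLieAlgebra m.+1 g) (rho : representation L V)
    (a : {ffun 'I_m -> g}) (b : {ffun 'I_m.+1 -> g}) (k : 'I_m) v :
  rho (omit (lift ord_max k) (snoc (n := m.+1) a (L b))) v =
  \sum_(i < m.+1) (-1) ^+ (m.+1 - i.+1) *:
    rho (omit i b) (rho (omit (lift ord_max k) (snoc (n := m.+1) a (b i))) v).
Proof.
case: m L rho a b k => [|m] L rho a b k; first by case: k.
rewrite omit_snoc_lift (rep_bracket rho).
by apply: eq_bigr => i _; rewrite omit_snoc_lift.
Qed.

Lemma rep_action_snoc m (L : nLieAlgebra m.+1 g) (rho : representation L V)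
    (a : {ffun 'I_m -> g}) (u : {ffun 'I_m -> V}) c z :
  rep_action rho (snoc (n := m.+1) a c) (snoc (n := m.+1) u z) =
  rho a z + \sum_(k < m) (-1) ^+ (m - k) *:
    rho (omit (lift ord_max k) (snoc (n := m.+1) a c)) (u k).
Proof.
rewrite /rep_action big_ord_recr /= subnn expr0 scale1r addrC.
rewrite omit_snoc_max snoc_max; congr (_ + _); apply: eq_bigr => k _.
have -> : widen_ord (leqnSn m) k = lift ord_max k.
  by apply: val_inj; apply: esym; apply: lift_max.
by rewrite snoc_lift.
Qed.

Lemma rep_action_fundamental m (L : nLieAlgebra m.+1 g)
    (rho : representation L V) (a : {ffun 'I_m -> g}) (u : {ffun 'I_m -> V})
    (b : {ffun 'I_m.+1 -> g}) (w : {ffun 'I_m.+1 -> V}) :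
  rep_action rho (snoc (n := m.+1) a (L b))
                 (snoc (n := m.+1) u (rep_action rho b w)) =
  \sum_(i < m.+1)
    rep_action rho (upd b i (L (snoc (n := m.+1) a (b i))))
      (upd w i (rep_action rho (snoc (n := m.+1) a (b i))
                               (snoc (n := m.+1) u (w i)))).
Proof.
under [RHS]eq_bigr => i _ do
  rewrite rep_action_upd rep_action_snoc linearD linear_sum scalerDr -addrA.
rewrite !big_split /= rep_action_snoc [RHS]addrCA [LHS]addrC.
congr (_ + _).
  under [LHS]eq_bigr => k _ do rewrite rep_bracket_omit scaler_sumr.
  rewrite exchange_big /=; apply: eq_bigr => i _.
  rewrite scaler_sumr; apply: eq_bigr => k _.
  by rewrite [in RHS]linearZ /= !scalerA mulrC.
rewrite (exchange_big_dep xpredT) //= -big_split /= /rep_action linear_sum.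
apply: eq_bigr => j _ /=; rewrite [in LHS]linearZ /= -scaler_sumr -scalerDr.
congr (_ *: _); apply/eqP; rewrite addrC -subr_eq; apply/eqP.
rewrite (rep_commutator rho) (reindex_omap (lift j) (unlift j)) /=; last first.
  by move=> i; case: unliftP => [k ->|->]; rewrite ?eqxx.
apply: eq_big => [k|k _]; first by rewrite liftK eqxx neq_lift.
by rewrite omit_upd_lift ffunE.
Qed.

End SemidirectFundamental.

Section SemidirectProduct.
Variables (F : fieldType) (n : nat) (g : lmodType F) (L : nLieAlgebra n g).
Variables (V : lmodType F) (rho : representation L V).

Lemma semidirect_fundamental
    (x : {ffun 'I_n.-1 -> g * V}) (y : {ffun 'I_n -> g * V}) :
  semidirect_bracket rho (snoc x (semidirect_bracket rho y)) =
  \sum_(i < n) semidirect_bracket rho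
    (upd y i (semidirect_bracket rho (snoc x (y i)))).
Proof.
have sumE (q : 'I_n -> g * V) :
    \sum_(i < n) q i = (\sum_(i < n) (q i).1, \sum_(i < n) (q i).2).
  by elim/big_rec3: _ => // i s1 s2 s3 _ ->.
rewrite sumE {1}/semidirect_bracket; congr pair.
  rewrite proj_g_snoc nlie_fundamental; apply: eq_bigr => i _ /=.
  by rewrite proj_g_upd /= proj_g_snoc ffunE.
case: n L rho x y {sumE} => [|m] L' rho' x y.
  by rewrite /rep_action !big_ord0.
have snd_upd i (z : g * V) :
    [ffun j => (upd y i z j).2] = upd [ffun j => (y j).2] i z.2.
  by apply/ffunP => j; rewrite !ffunE; case: eqP.
have snd_snoc (z : g * V) :
    [ffun j => (snoc (n := m.+1) x z j).2] =
    snoc (n := m.+1) [ffun k => (x k).2] z.2.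
  by apply/ffunP => j; rewrite !ffunE; case: insub => // k; rewrite ffunE.
rewrite proj_g_snoc snd_snoc rep_action_fundamental; apply: eq_bigr => i _ /=.
by rewrite proj_g_upd snd_upd /= proj_g_snoc snd_snoc !ffunE.
Qed.

Definition semidirect : nLieAlgebra n (g * V)%type :=
  NLieAlgebra (semidirect_multilinear rho) (semidirect_alternating rho)
    semidirect_fundamental.

End SemidirectProduct.

Definition O_operator (F : fieldType) (n : nat) (g : lmodType F)
    (L : nLieAlgebra n g) (V : lmodType F) (rho : representation L V)
    (T : {linear V -> g}) : Prop :=
  forall v : {ffun 'I_n -> V},
    L [ffun i => T (v i)] =
    \sum_(i < n) (-1) ^+ (n - i.+1) *:
      T (rho (omit i [ffun j => T (v j)]) (v i)).

Section Nijenhuis.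
Variables (F : fieldType) (n : nat) (g : lmodType F) (L : nLieAlgebra n g).
Variable N : {linear g -> g}.

(** [x_1, ..., x_n]_N^j, where a choice of positions i_1 < ... < i_j is encoded
    as a [j]-element set [A]; with the convention that the bracket for [j = 0]
    is the original one, the case [j = 1] obeys the same recursion. *)
Fixpoint nijenhuis_bracket (j : nat) (x : {ffun 'I_n -> g}) : g :=
  if j is j'.+1 then
    \sum_(A : {set 'I_n} | #|A| == j)
      L [ffun i => if i \in A then N (x i) else x i]
    - N (nijenhuis_bracket j' x)
  else L x.

Definition nijenhuis_operator : Prop :=
  forall x : {ffun 'I_n -> g},
    L [ffun i => N (x i)] = N (nijenhuis_bracket n.-1 x).

End Nijenhuis.

Section Bar.
Variables (F : fieldType) (g V : lmodType F) (T : {linear V -> g}).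

Definition bar_op (p : g * V) : g * V := (T p.2, 0).

Lemma bar_op_is_linear : linear bar_op.
Proof.
move=> a p q; rewrite /bar_op linearP; congr pair.
by rewrite /= scaler0 addr0.
Qed.

HB.instance Definition _ :=
  GRing.isLinear.Build F (g * V)%type (g * V)%type *:%R bar_op bar_op_is_linear.

End Bar.

(* Main.v *)
(** The operator [bar_op T] squares to zero, so in [N [x_1, ..., x_n]_N^(n-1)]
    only the sum over the [n-1]-element sets of positions survives.  Leaving out
    the position [i], all entries but the [i]-th lose their [V]-component, and
    the [V]-component of the bracket reduces to the [i]-th term of the
    O-operator identity. *)
Require Import Defs.
From mathcomp Require Import all_boot all_order all_fingroup all_algebra.

Set Implicit Arguments.
Unset Strict Implicit.
Unset Printing Implicit Defensive.

Import GRing.Theory.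

Local Open Scope ring_scope.

(** Complementation matches these sets with the singletons. Positivity of [n] matters: for [n = 0]
    the left sum would still contain the empty set. *)
Lemma big_card_predn (R : nmodType) (n : nat) (f : {set 'I_n} -> R) :
  (0 < n)%N ->
  \sum_(A : {set 'I_n} | #|A| == n.-1) f A = \sum_(i < n) f [set~ i].
Proof.
move=> n_gt0; rewrite -[RHS](big_imset f (A := predT)) /=; last first.
  by move=> i j _ _ /setC_inj/set1_inj.
apply: eq_bigl => A; apply/idP/imsetP => [/eqP cA|[i _ ->]]; last first.
  by rewrite cardsC1 card_ord.
have /eqP/cards1P[i ei] : #|~: A| = 1%N.
  by rewrite cardsCs setCK cA card_ord -subn1 subKn.
by exists i => //; rewrite -ei setCK.
Qed.

Section BarOperator.
Variables (F : fieldType) (n : nat) (g V : lmodType F) (L : nLieAlgebra n g).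
Variables (rho : representation L V) (T : {linear V -> g}).

Lemma bar_op_nilpotent (p : g * V) : bar_op T (bar_op T p) = 0.
Proof. by rewrite /bar_op /= linear0. Qed.

Lemma semidirect_bar_op (x : {ffun 'I_n -> g * V}) :
  semidirect rho [ffun i => bar_op T (x i)] = (L [ffun i => T (x i).2], 0).
Proof.
congr pair; first by congr (L _); apply/ffunP => i; rewrite !ffunE.
by rewrite /rep_action big1 // => i _; rewrite !ffunE linear0 scaler0.
Qed.

Lemma semidirect_bar_op_setC1 (x : {ffun 'I_n -> g * V}) (i : 'I_n) :
  (semidirect rho
     [ffun j => if j \in [set~ i] then bar_op T (x j) else x j]).2 =
  (-1) ^+ (n - i.+1) *: rho (omit i [ffun j => T (x j).2]) (x i).2.
Proof.
rewrite /= /rep_action (bigD1 i) //= big1 ?addr0 => [|j ji].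
  (* The surviving term omits position [i], the only one where [bar_op T] was not applied. *)
  rewrite !ffunE !inE eqxx /=; congr (_ *: rho _ _).
  by apply/ffunP => k; rewrite !ffunE !inE eq_sym neq_lift.
by rewrite !ffunE !inE ji /= linear0 scaler0.
Qed.

Lemma bar_op_nijenhuis_bracket (x : {ffun 'I_n -> g * V}) : (1 < n)%N ->
  bar_op T (nijenhuis_bracket (semidirect rho) (bar_op T) n.-1 x) =
  (\sum_(i < n) (-1) ^+ (n - i.+1) *:
     T (rho (omit i [ffun j => T (x j).2]) (x i).2), 0).
Proof.
(* Exposing a successor unfolds the recursion once; for [n = 1] the index would be 0 and the bracket
   the original one. *)
move=> n_gt1; have n1 : n.-1 = n.-2.+1 by case: n n_gt1 => [|[]].
rewrite n1 /= linearB /= bar_op_nilpotent subr0 -n1.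
rewrite (big_card_predn _ (ltnW n_gt1)) {1}/bar_op; congr pair.
rewrite (raddf_sum (@snd g V)) /= linear_sum /=; apply: eq_bigr => i _.
by rewrite -linearZ -semidirect_bar_op_setC1.
Qed.

End BarOperator.

Theorem proposition3p15 (F : fieldType) (n : nat) (hn : (2 <= n)%N)
    (g : lmodType F) (L : nLieAlgebra n g) (V : lmodType F)
    (rho : representation L V) (T : {linear V -> g}) :
  O_operator rho T <->
  nijenhuis_operator (semidirect rho)
    (bar_op T : {linear (g * V)%type -> (g * V)%type}).
Proof.
split=> [OT x | NT v].
  (* Both [V]-components are 0, and the [g]-components form the O-operator identity at the
     [V]-components of [x]. *)
  rewrite semidirect_bar_op [RHS]bar_op_nijenhuis_bracket //; congr pair.
  have := OT [ffun i => (x i).2].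
  have -> : [ffun i => T ([ffun j => (x j).2] i)] = [ffun i => T (x i).2].
    by apply/ffunP => i; rewrite !ffunE.
  by move=> ->; apply: eq_bigr => i _; rewrite ffunE.
(* Only [V]-components enter the identity, so testing on the vectors [(0, v i)] recovers the
   O-operator condition. *)
have := NT [ffun i => (0, v i)].
rewrite semidirect_bar_op [X in _ = X]bar_op_nijenhuis_bracket // => -[].
have -> : [ffun i => T ([ffun j => (0 : g, v j)] i).2] = [ffun i => T (v i)].
  by apply/ffunP => i; rewrite !ffunE.
by move=> ->; apply: eq_bigr => i _; rewrite ffunE.
Qed.
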